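(* Let $p$ be a prime and let $k\ge p+2$ be an integer. There exists a sequence $(\epsilon_n)_{n\ge1}$ of non-negative real numbers, depending only on $p$ and $k$, with $\epsilon_n\to0$ as $n\to\infty$, such that for every positive integer $n$ there exists a function $f\colon\mathbb{F}_p^n\to\mathbb{C}$ satisfying $\|f\|_\infty\le 1$ and $\|f\|_{U^k}=1$ such that for all classical polynomials $P\in\operatorname{Poly}_{\leqslant k-1}(\mathbb{F}_p^n\to\mathbb{F}_p)$, \[\left|\mathbb{E}_{x\in\mathbb{F}_p^n} f(x)\,e_p(-P(x))\right|\le\epsilon_n.\]
   Context: $\mathbb{E}_{x\in S}$ denotes the uniform average over the finite set $S$, and $\|f\|_\infty=\max_{x}|f(x)|$. For $x\in\mathbb{F}_p$, $|x|\in\{0,\ldots,p-1\}$ is the standard integer representative, and $e_p\colon\mathbb{F}_p\to\mathbb{C}$ is $e_p(x)=e^{2\pi i|x|/p}$. Write $V=\mathbb{F}_p^n$. For $f\colon V\to\mathbb{C}$ and $h\in V$, the multiplicative derivative $\partial_h f\colon V\to\mathbb{C}$ is $(\partial_h f)(x)=f(x+h)\overline{f(x)}$. For $d\ge 1$ the Gowers uniformity norm is \[\|f\|_{U^d}=\left|\mathbb{E}_{x,h_1,\ldots,h_d\in V}(\partial_{h_1}\cdots\partial_{h_d}f)(x)\right|^{1/2^d}.\] For an abelian group $G$, a function $P\colon V\to G$ and $h\in V$, the additive derivative is $(\Delta_hP)(x)=P(x+h)-P(x)$. A classical polynomial of degree at most $d$ is a map $P\colon V\to\mathbb{F}_p$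 with $(\Delta_{h_1}\cdots\Delta_{h_{d+1}}P)(x)=0$ for all $h_1,\ldots,h_{d+1},x\in V$; the set of these is $\operatorname{Poly}_{\leqslant d}(V\to\mathbb{F}_p)$. *)

(* Defs.v *)
From HB Require Import structures.
From mathcomp Require Import all_boot all_order all_algebra.
From mathcomp Require Import all_classical all_reals all_analysis.
From mathcomp Require Import complex.

Set Implicit Arguments.
Unset Strict Implicit.
Unset Printing Implicit Defensive.

Import Order.TTheory GRing.Theory Num.Theory numFieldNormedType.Exports.

Local Open Scope ring_scope.

(* The modulus of a complex number, as an element of R itself: the norm `|z|
   of R[i] is the same number viewed in R[i]. *)
Definition cmod (R : realType) (z : R[i]) : R := ComplexField.Normc.normc z.

Definition expect (R : realType) (T : finType) (F : T -> R[i]) : R[i] :=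
  (#|T|%:R)^-1 * \sum_(x : T) F x.

(* All moduli are nonnegative, so starting the maximum at 0 is harmless. *)
Definition sup_norm (R : realType) (T : finType) (F : T -> R[i]) : R :=
  \big[Num.max/0]_(x : T) cmod (F x).

(* e_p(x) = exp(2 i pi |x| / p); the coercion from 'F_p to nat is the standard
   representative |x|, which lies in {0, ..., p - 1} when p is prime. *)
Definition ep (R : realType) (p : nat) (x : 'F_p) : R[i] :=
  let theta : R := 2 * pi * (nat_of_ord x)%:R / p%:R in
  Complex (cos theta) (sin theta).

Definition mderiv (R : realType) (V : zmodType) (h : V) (f : V -> R[i]) :
    V -> R[i] :=
  fun x => f (x + h) * (f x)^*.

Definition aderiv (V G : zmodType) (h : V) (P : V -> G) : V -> G :=
  fun x => P (x + h) - P x.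

(* foldr applies the derivative in direction h_d first and h_1 last. *)
Definition gowers_norm (R : realType) (V : finZmodType) (d : nat)
    (f : V -> R[i]) : R :=
  cmod (expect (fun u : V * d.-tuple V => foldr (@mderiv R V) f u.2 u.1))
    `^ (2 ^+ d)^-1.

Definition poly_le (p n d : nat) (P : 'rV['F_p]_n -> 'F_p) : Prop :=
  forall (h : d.+1.-tuple 'rV['F_p]_n) (x : 'rV['F_p]_n),
    foldr (@aderiv 'rV['F_p]_n 'F_p) P h x = 0.

(* Main.v *)
Require Import Defs.
From mathcomp Require Import all_boot all_order all_algebra.
From mathcomp Require Import cyclic cyclotomic separable.
From mathcomp Require Import all_classical all_reals all_analysis.
From mathcomp Require Import complex.
From mathcomp Require Import ring zify.

(** Put D = k - 1, so that D > p, and take N : F_p -> Z/p^t of degree exactly D,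
with constant nonzero D-th derivative L(h_1, ..., h_D).  The function is
f(x) = chi(N(x_1) + ... + N(x_n)) with chi a faithful character of Z/p^t; its
D-th derivative is chi of the diagonal form sum_a L(h_1(a), ..., h_D(a)).

Given a classical P of degree at most D, Ramsey's theorem yields a large set of
coordinates along which P looks the same on all subsets of a given size.  Cut it
into blocks of size p, let h_i be the indicator of the i-th block and g_i that of
its first point.  Then the D-linear form of P vanishes at (h_i1, ..., h_i(D-1), g_j):
- if some h_i occurs at least p times, because (shift - 1)^p = 0 in characteristic p;
- otherwise some h_i with i <> j occurs r times, 0 < r < p.  Replacing it by the
  indicator of a subset B of the block gives a polynomial of degree r < p in B that
  only depends on |B|.  So the p-th difference of this function of |B| is 0, and in
  characteristic p it is value(p) - value(0), while value(0) = 0.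
Van der Corput's inequality with all shifts in the span of the h_i but one, which is
in the span of the g_i, therefore eliminates P, and bounds |E f e_p(-P)|^(2^D) by
kappa^m, where m is the number of blocks and kappa, |kappa| < 1, is the average of
chi(L) over F_p^D. *)

Import Order.TTheory GRing.Theory Num.Theory numFieldNormedType.Exports.

Local Open Scope classical_set_scope.
Local Open Scope ring_scope.

Set Implicit Arguments.
Unset Strict Implicit.
Unset Printing Implicit Defensive.

(** * Ramsey's theorem for subsequences *)

Definition homogeneous (T : eqType) (K : Type) (d : nat) (c : seq T -> K) (k : K) (t : seq T) :=
  forall e, subseq e t -> size e = d -> c e = k.

(* The colour of a subsequence of size d + 1 depends only on its first element. *)
Fixpoint head_homogeneous (T : eqType) (K : Type) (d : nat) (c : seq T -> K) (t : seq T) :=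
  if t is a :: t' then
    (exists k, homogeneous d (fun e => c (a :: e)) k t')
    /\ head_homogeneous d c t'
  else True.

(** File each element of t under a colour that it gives, as a head, to the subsequences it starts.
    Within one class the first element then settles the colour, and the sizes add up, ready for a
    pigeonhole argument. *)
Lemma head_homogeneous_split (T : eqType) (K : finType) (d : nat) (c : seq T -> K) (t : seq T) :
  head_homogeneous d c t ->
  exists u : K -> seq T, (forall k, subseq (u k) t /\ homogeneous d.+1 c k (u k))
    /\ (\sum_k size (u k) = size t)%N.
Proof.
elim: t => [|a t IHt] /=.
  move=> _; exists (fun _ => [::]); split; last by rewrite big1.
  by move=> k; split=> // e; rewrite subseq0 => /eqP ->.
move=> [[k0 hk0] /IHt [u [hu su]]].
exists (fun k => if k == k0 then a :: u k else u k); split; last first.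
  rewrite -su (bigD1 k0) //= eqxx [in RHS](bigD1 k0) //= addSn; congr (_ + _).+1.
  by apply: eq_bigr => k /negbTE ->.
move=> k; have [sk hk] := hu k; case: eqP => [-> {k sk hk}|_]; last first.
  by split=> //; exact: (subseq_trans sk (subseq_cons t a)).
have [sk hk] := hu k0; split; first by rewrite /= eqxx.
case=> [//|b e] /=; case: eqP => [->|_] se [ze].
  exact: hk0 (subseq_trans se sk) ze.
by apply: hk => //=; rewrite ze.
Qed.

Lemma ramsey (K : finType) (d m : nat) :
  exists N, forall (T : eqType) (c : seq T -> K) (s : seq T), (N <= size s)%N ->
    exists t k, [/\ subseq t s, size t = m & homogeneous d c k t].
Proof.
elim: d m => [|d IHd] m.
  exists m => T c s ms; exists (take m s), (c [::]).
  by split; [exact: take_subseq|rewrite size_takel|move=> e _ /size0nil ->].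
(* The length m * #|K| is what the pigeonhole over the colours needs to leave m elements in one
   class. *)
have [N hN] : exists N, forall (T : eqType) (c : seq T -> K) (s : seq T), (N <= size s)%N ->
    exists t, [/\ subseq t s, size t = (m * #|K|)%N & head_homogeneous d c t].
  elim: (m * #|K|)%N => [|L [N hN]].
    by exists 0 => T c s _; exists [::]; split=> //; rewrite sub0seq.
  (* Keep the head a, apply the case d to the tail coloured by c (a :: e), and continue inside the
     homogeneous list so obtained. *)
  have [N' hN'] := IHd N; exists N'.+1 => T c [//|a s] /= ls.
  have [t [k [ts zt ht]]] := hN' _ (fun e => c (a :: e)) _ ls.
  have [|t' [ts' zt' ht']] := hN _ c t; first by rewrite zt.
  exists (a :: t'); split=> /=; [|by rewrite zt'|].
    by rewrite eqxx; apply: subseq_trans ts' ts.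
  split=> //; exists k => e se; apply: ht; exact: subseq_trans se ts'.
exists N => T c s ms.
have [t [ts zt /head_homogeneous_split [u [hu su]]]] := hN _ c s ms.
have [k mk] : exists k, (m <= size (u k))%N.
  have [k0 _|K0] := pickP K.
    case: (boolP [exists k, m <= size (u k)]%N) => [/existsP //|/existsPn hm].
    move: su; rewrite zt => /eqP; rewrite eqn_leq => /andP[_].
    rewrite leqNgt => /negP[]; rewrite mulnC -sum_nat_const.
    rewrite (bigD1 k0) //= [ltnRHS](bigD1 k0) //= -addSn leq_add //.
      by rewrite ltnNge hm.
    by apply: leq_sum => k _; apply: ltnW; rewrite ltnNge hm.
  by have := K0 (c [::]).
have [sk hk] := hu k; exists (take m (u k)), k; split.
- apply: subseq_trans ts; apply: subseq_trans sk; exact: take_subseq.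
- by rewrite size_takel.
- move=> e se; apply: hk; apply: subseq_trans se _; exact: take_subseq.
Qed.

(** * Iterated additive derivatives *)

Notation aderivs := (foldr (@aderiv _ _)).

(** The notion [poly_le] with lists for tuples and an arbitrary target group, so that it also covers
    the non-classical N. *)
Definition deg_le (V G : zmodType) (d : nat) (P : V -> G) :=
  forall hs x, size hs = d.+1 -> aderivs P hs x = 0.

Lemma aderivC (V G : zmodType) (a b : V) (P : V -> G) :
  aderiv a (aderiv b P) = aderiv b (aderiv a P).
Proof.
by apply/funext => x; rewrite /aderiv (addrAC x a b) !opprD addrACA.
Qed.

Lemma aderivs_cons (V G : zmodType) (a : V) hs (P : V -> G) :
  aderivs (aderiv a P) hs = aderiv a (aderivs P hs).
Proof. by elim: hs => //= b hs ->; rewrite aderivC. Qed.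

Lemma aderivs_perm (V G : zmodType) (s t : seq V) (P : V -> G) :
  perm_eq s t -> aderivs P s = aderivs P t.
Proof.
elim: s t => [|a s IHs] t; first by rewrite perm_sym => /perm_nilP ->.
move=> st.
have ta : a \in t by rewrite -(perm_mem st) mem_head.
have [t1 [t2 def_t]] : exists t1 t2, t = t1 ++ a :: t2.
  by case/splitPr: ta => t1 t2; exists t1, t2.
have {}st : perm_eq s (t1 ++ t2).
  rewrite -(perm_cons a) (perm_trans st) // def_t.
  exact/permPl/(perm_catCA t1 [:: a] t2).
by rewrite /= (IHs _ st) def_t !foldr_cat /= aderivs_cons.
Qed.

Lemma aderivs_comp (V W G : zmodType) (E : W -> V) (P : V -> G) hs x :
  {morph E : y z / y + z} -> aderivs (P \o E) hs x = aderivs P (map E hs) (E x).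
Proof. by move=> ED; elim: hs x => [//|h hs IHs] x; rewrite /= /aderiv !IHs ED. Qed.

Lemma aderivs_sum (V G : zmodType) (I : Type) (r : seq I) (Q : pred I) (F : I -> V -> G) hs x :
  aderivs (fun y => \sum_(i <- r | Q i) F i y) hs x = \sum_(i <- r | Q i) aderivs (F i) hs x.
Proof. by elim: hs x => [//|h hs IHs] x; rewrite /= /aderiv !IHs sumrB. Qed.

Lemma aderivs_mulrz (V G : zmodType) (c : int) (F : V -> G) hs x :
  aderivs (fun y => F y *~ c) hs x = aderivs F hs x *~ c.
Proof. by elim: hs x => [//|h hs IHs] x; rewrite /= /aderiv !IHs mulrzBl. Qed.

Lemma aderivs0 (V G : zmodType) (P : V -> G) hs x : 0 \in hs -> aderivs P hs x = 0.
Proof.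
elim: hs x => [//|h hs IHs] x; rewrite inE /= /aderiv => /orP[/eqP <-|h0].
  by rewrite addr0 subrr.
by rewrite !IHs // subrr.
Qed.

Lemma aderivs_big_size (V G : zmodType) d (P : V -> G) hs x :
  deg_le d P -> (d < size hs)%N -> aderivs P hs x = 0.
Proof.
move=> dP; elim: hs x => [//|h hs IHs] x /=; rewrite ltnS leq_eqVlt => /orP[/eqP dhs|dhs].
  by apply: (dP (h :: hs)); rewrite /= dhs.
by rewrite /aderiv !IHs // subrr.
Qed.

(** The difference of two values of a d-th derivative is a derivative of order d + 1. Being free to
    move the base point is what makes the top derivative multilinear in the directions. *)
Lemma aderivs_const (V G : zmodType) d (P : V -> G) hs x y :
  deg_le d P -> size hs = d -> aderivs P hs x = aderivs P hs y.
Proof.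
move=> dP zhs; have := dP (x - y :: hs) y; rewrite /= zhs /aderiv (addrC y) subrK.
by move=> /(_ erefl)/subr0_eq.
Qed.

Lemma aderivs_addl (V G : zmodType) d (P : V -> G) a b hs x :
  deg_le d P -> (size hs).+1 = d ->
  aderivs P (a + b :: hs) x = aderivs P (a :: hs) x + aderivs P (b :: hs) x.
Proof.
move=> dP zhs; rewrite (aderivs_const (hs := a :: hs) x (x + b) dP) //= /aderiv.
by rewrite -(addrA x) (addrC b a) subrKA.
Qed.

Lemma aderivs_mulrnl (V G : zmodType) d (P : V -> G) a n hs x :
  deg_le d P -> (size hs).+1 = d ->
  aderivs P (a *+ n :: hs) x = aderivs P (a :: hs) x *+ n.
Proof.
move=> dP zhs; elim: n => [|n IHn]; first by rewrite !mulr0n aderivs0 ?mem_head.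
by rewrite !mulrS (aderivs_addl _ _ _ dP) // IHn.
Qed.

Lemma aderivs_suml (V G : zmodType) d (P : V -> G) (I : Type) (r : seq I) (F : I -> V) hs x :
  deg_le d P -> (size hs).+1 = d ->
  aderivs P (\sum_(i <- r) F i :: hs) x = \sum_(i <- r) aderivs P (F i :: hs) x.
Proof.
move=> dP zhs; elim: r => [|i r IHr]; first by rewrite !big_nil aderivs0 ?mem_head.
by rewrite !big_cons (aderivs_addl _ _ _ dP) // IHr.
Qed.

(** Expansion of (S - 1)^n, where S is the shift by h. The sign uses n + i, of the same parity as n
    - i, to avoid truncated subtraction. *)
Lemma aderivs_nseq (V G : zmodType) (P : V -> G) h n x :
  aderivs P (nseq n h) x =
    \sum_(i < n.+1) P (x + h *+ i) *~ ((-1) ^+ (n + i) * 'C(n, i)%:Z).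
Proof.
elim: n x => [|n IHn] x /=; first by rewrite big_ord1 /= mulr0n addr0 mulr1.
rewrite /aderiv !IHn [in RHS]big_ord_recl /=.
have -> : \sum_(i < n.+1) P (x + h *+ i) *~ ((-1) ^+ (n + i) * 'C(n, i)%:Z) =
    \sum_(i < n.+2) P (x + h *+ i) *~ ((-1) ^+ (n + i) * 'C(n, i)%:Z).
  by rewrite [RHS]big_ord_recr /= bin_small // mulr0 mulr0z addr0.
rewrite [in X in _ - X]big_ord_recl /= !bin0 !addn0 exprS mulN1r !mulr1 mulrNz opprD.
rewrite addrCA; congr (_ + _); rewrite -sumrB; apply: eq_bigr => i _.
rewrite /bump /= add1n mulrSr -addrA (addrC h) addrA -mulrzBr; congr (_ *~ _).
rewrite binS PoszD addSn addnS !exprS; ring.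
Qed.

(** The inner binomial coefficients are divisible by p, so (S - 1)^p is S^p - 1 modulo p. The
    remainder g matters when the target is Z/p^t. *)
Lemma aderivs_pnseq (V G : zmodType) p (P : V -> G) h : prime p ->
  exists g : V -> G, forall x, aderivs P (nseq p h) x = P (x + h *+ p) - P x + g x *+ p.
Proof.
move=> p_prime; have p_gt0 := prime_gt0 p_prime.
(* For p = 2 the sign of the term i = 0 is 1 = -1 + 2; the excess, a multiple of p, is absorbed by
   g. *)
have [c hc] : exists c : int, (-1) ^+ p = -1 + c * p%:Z.
  have [->|p2] := even_prime p_prime; first by exists 1; rewrite expr2.
  by exists 0; rewrite -signr_odd p2 expr1 mul0r addr0.
exists (fun x => P x *~ c + \sum_(i < p.-1) P (x + h *+ i.+1) *~
  ((-1) ^+ (p + i.+1) * ('C(p, i.+1) %/ p)%N%:Z)) => x.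
have splitp (F : nat -> G) : \sum_(i < p) F i = F 0%N + \sum_(i < p.-1) F i.+1.
  by rewrite -[in LHS](prednK p_gt0) big_ord_recl.
rewrite aderivs_nseq big_ord_recr /=.
rewrite (splitp (fun i => P (x + h *+ i) *~ ((-1) ^+ (p + i) * 'C(p, i)%:Z))) /=.
rewrite bin0 binn !mulr1 mulr0n addn0 addnn -mul2n exprM sqrrN !expr1n addr0.
rewrite hc mulrzDr mulrN1z mulrnDl addrC !addrA mulr1z mulrzA -pmulrn; congr (_ + _).
rewrite -sumrMnl; apply: eq_bigr => i _.
rewrite [RHS]pmulrn -mulrzA -mulrA -PoszM divnK //.
by rewrite prime_dvd_bin //= -ltn_predRL.
Qed.

(** * Vanishing of the form of a classical polynomial *)

(* The binomial formula writes the diagonal as a combination of the functions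
   h |-> (aderivs P o) (h *+ i), which have degree at most r. *)
Lemma aderivs_diag (V G : zmodType) d r (P : V -> G) o vs x :
  deg_le d P -> (size o + r = d)%N -> (r < size vs)%N ->
  aderivs (fun h => aderivs P (nseq r h ++ o) 0) vs x = 0.
Proof.
move=> dP so rvs.
rewrite (_ : (fun h => _) = fun h => \sum_(i < r.+1) aderivs P o (h *+ i) *~
  ((-1) ^+ (r + i) * 'C(r, i)%:Z)); last first.
  by apply/funext => h; rewrite foldr_cat aderivs_nseq; under eq_bigr do rewrite add0r.
rewrite aderivs_sum big1 // => i _; rewrite aderivs_mulrz.
rewrite (aderivs_comp (E := fun h => h *+ i) (aderivs P o)) => [|y z]; last exact: mulrnDl.
rewrite -foldr_cat (aderivs_big_size _ dP) ?mul0rz //.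
by rewrite size_cat size_map; lia.
Qed.

(** A difference in a direction v of w compares the masks with and without v, whose counts differ by
    one. The offset s counts the directions already moved into the base point x. *)
Lemma aderivs_mask (V G : zmodType) (Q : V -> G) (g : int -> G) (w : seq V) x (s : int) :
  (forall b, size b = size w -> Q (x + \sum_(v <- mask b w) v) = g (s + (count id b)%:Z)) ->
  aderivs Q w x = aderivs g (nseq (size w) 1) s.
Proof.
elim: w x s => [|v w IHw] x s Qg /=.
  by have := Qg [::] erefl; rewrite big_nil !addr0.
rewrite /aderiv (IHw (x + v) (s + 1)) ?(IHw x s) // => b sb.
  by have := Qg (false :: b); rewrite /= sb => /(_ erefl) ->.
have := Qg (true :: b); rewrite /= sb => /(_ erefl); rewrite big_cons addrA => ->.
by rewrite PoszD addrA.
Qed.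

(** Coordinates on the span of the list e; Ramsey's theorem will colour e by the whole function P
    (comb e y) of y. *)
Definition comb (K : nzRingType) (V : lmodType K) d (e : seq V) (y : 'rV[K]_d) : V :=
  \sum_(j < d) y 0 j *: e`_j.

Lemma combD (K : nzRingType) (V : lmodType K) d (e : seq V) :
  {morph @comb K V d e : y z / y + z}.
Proof. by move=> y z; rewrite /comb -big_split; apply: eq_bigr => j _; rewrite mxE scalerDl. Qed.

Definition interval_row (K : nzRingType) d (a l : nat) : 'rV[K]_d :=
  \row_(j < d) ((a <= j < a + l)%N)%:R.

Lemma comb_interval (K : nzRingType) (V : lmodType K) d (e : seq V) a l : (a + l <= d)%N ->
  comb e (interval_row K d a l) = \sum_(i < l) e`_(a + i).
Proof.
move=> ald; rewrite /comb.
rewrite (eq_bigr (fun j : 'I_d => if (a <= j < a + l)%N then e`_j else 0)); last first.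
  by move=> j _; rewrite mxE; case: ifP; rewrite ?scale1r ?scale0r.
rewrite -big_mkcond -(big_mkord (fun j => a <= j < a + l)%N (fun j => e`_j)).
transitivity (\sum_(a <= j < a + l) e`_j).
  rewrite [RHS](big_nat_widen _ _ _ _ _ ald) [RHS](big_nat_widenl _ 0%N) //.
  by apply: eq_bigl => j; rewrite andTb andbC.
by rewrite -{1}(add0n a) big_addn addKn big_mkord; apply: eq_bigr => i _; rewrite addnC.
Qed.

(** The pair is (start, length): (i * p, p) is the i-th block and (i * p, 1) its first point. *)
Definition interval_sum (V : nmodType) (t : seq V) (x : nat * nat) : V :=
  \sum_(i < x.2) t`_(x.1 + i).

Lemma sum_take (V : nmodType) (s : seq V) : \sum_(i < size s) s`_i = \sum_(v <- s) v.
Proof. by rewrite (big_nth 0) big_mkord. Qed.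

(** The intervals in o avoid w and end by position d, so they remain intervals, at most translated,
    when w is thinned out. The p entries beyond position d are spare. *)
Lemma aderivs_block_eq0 (p : nat) (V : lmodType 'F_p) d D r (P : V -> 'F_p)
    (k : 'rV['F_p]_d -> 'F_p) (t1 w t2 : seq V) s1 (o : seq (nat * nat)) :
  prime p -> deg_le D P -> size t1 = s1 -> size w = p ->
  homogeneous d (fun e y => P (comb e y)) k (t1 ++ w ++ t2) ->
  (d + p = size (t1 ++ w ++ t2))%N ->
  (forall a l : nat, (a, l) \in o -> a + l <= s1 \/ s1 + p <= a /\ a + l <= d)%N ->
  (s1 + p <= d)%N ->
  (0 < r < p)%N -> (size o + r = D)%N ->
  aderivs P (nseq r (\sum_(v <- w) v) ++ map (interval_sum (t1 ++ w ++ t2)) o) 0 = 0.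
Proof.
move=> p_prime dP st1 sw hk sd ho s1d /andP[r0 rp] so.
(* Keeping s points of the block w shifts the points after it by p - s positions. *)
pose sh s (x : nat * nat) := if (x.1 + x.2 <= s1)%N then x.1 else (x.1 - (p - s))%N.
pose o' s := [seq interval_row 'F_p d (sh s x) x.2 | x <- o].
(* Computed from the common colour k, this depends only on the number of points kept. The absolute
   value makes g a function on a group, so that it can be differenced. *)
pose g (z : int) := aderivs k (nseq r (interval_row 'F_p d s1 `|z|%N) ++ o' `|z|%N) 0.
pose Q h := aderivs P (nseq r h ++ map (interval_sum (t1 ++ w ++ t2)) o) 0.
have Qg b : size b = size w -> Q (0 + \sum_(v <- mask b w) v) = g (0 + (count id b)%:Z).
  move=> sb; rewrite !add0r /g /=; set s := count id b.
  have sm : size (mask b w) = s by rewrite size_mask.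
  have sp : (s <= p)%N by rewrite -sw -sb count_size.
  (* Points dropped from w are replaced by more points of t2, so that e has size d for every s and
     homogeneity applies. *)
  pose e := t1 ++ mask b w ++ take (d - s1 - s) t2.
  have se : subseq e (t1 ++ w ++ t2).
    by rewrite !cat_subseq ?take_subseq ?mask_subseq.
  have ze : size e = d.
    by move: sd; rewrite /e !size_cat st1 sm sw => sd; rewrite size_takel; lia.
  rewrite -(hk e se ze) (aderivs_comp (E := comb e)); last exact: combD.
  rewrite /Q; congr (aderivs P _ _); last by rewrite /comb big1 // => j _; rewrite mxE scale0r.
  rewrite map_cat map_nseq; congr (nseq _ _ ++ _).
    rewrite comb_interval; last lia.
    rewrite -sum_take sm; apply: eq_bigr => i _.
    by rewrite /e !nth_cat st1 ltnNge leq_addr /= addKn sm ltn_ord.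
  rewrite /o' -map_comp; apply/eq_in_map => -[a0 l0].
  move: (a0 : nat) (l0 : nat) => a l {a0 l0} /ho hx.
  rewrite /= comb_interval /sh /=; last by case: ifP; lia.
  rewrite /interval_sum /=; apply: eq_bigr => i _; have il := ltn_ord i.
  rewrite /e !nth_cat st1; case: (leqP (a + l) s1) => al.
    by have -> : (a + i < s1)%N by lia.
  have -> : (a + i < s1)%N = false by lia.
  have -> : (a - (p - s) + i < s1)%N = false by lia.
  rewrite sw sm.
  have -> : (a + i - s1 < p)%N = false by lia.
  have -> : (a - (p - s) + i - s1 < s)%N = false by lia.
  by rewrite nth_take; [congr (t2`_ _)|]; lia.
have g0 : g 0 = 0.
  have := Qg (nseq p false); rewrite size_nseq sw => /(_ erefl).
  rewrite mask_false big_nil addr0 add0r count_nseq mul0n => <-.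
  by rewrite /Q aderivs0 // mem_cat mem_nseq r0 eqxx.
have [f hf] := aderivs_pnseq g 1 p_prime.
(* The p-th unit difference of g is g p - g 0 in characteristic p, and it is 0 because [Q] has
   degree at most r < p. *)
have := aderivs_mask (x := 0) (s := 0) Qg; rewrite sw hf.
rewrite (aderivs_diag _ dP) ?size_map ?sw // g0 subr0 add0r -[f 0 *+ p]mulr_natr.
rewrite pchar_Fp_0 // mulr0 addr0.
have := Qg (nseq p true); rewrite size_nseq sw => /(_ erefl).
rewrite mask_true ?sw // !add0r count_nseq mul1n => Qw; rewrite natz => h.
by rewrite -[LHS]/(Q _) Qw -h.
Qed.

Lemma aderivs_repeat_eq0 p (V : lmodType 'F_p) (P : V -> 'F_p) h n hs x :
  prime p -> (p <= n)%N -> aderivs P (nseq n h ++ hs) x = 0.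
Proof.
move=> p_prime pn; rewrite -(subnKC pn) nseqD -catA foldr_cat.
have [g ->] := aderivs_pnseq (aderivs P (nseq (n - p) h ++ hs)) h p_prime.
by rewrite -scaler_nat -[X in _ + X]mulr_natr pchar_Fp_0 // scale0r addr0 subrr mulr0 addr0.
Qed.

Lemma perm_nseq_count (T : eqType) (a : T) s :
  perm_eq s (nseq (count_mem a s) a ++ seq.filter (predC1 a) s).
Proof.
rewrite -(perm_filterC (pred1 a) s) -size_filter.
have /all_pred1P <- // := filter_all (pred1 a) s.
Qed.

Lemma aderivs_homogeneous_eq0 p (V : lmodType 'F_p) q m (P : V -> 'F_p) k t
    (s : seq 'I_m) (j : 'I_m) :
  prime p -> deg_le q.+1 P -> (p <= q)%N -> size s = q -> (size t = m * p + p)%N ->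
  homogeneous (m * p) (fun e (y : 'rV['F_p]_(m * p)) => P (comb e y)) k t ->
  aderivs P ([seq interval_sum t (i * p, p)%N | i : 'I_m <- s] ++
             [:: interval_sum t (j * p, 1)%N]) 0 = 0.
Proof.
move=> p_prime dP pq sq st hk; have p_gt0 := prime_gt0 p_prime.
pose h (i : 'I_m) := interval_sum t (i * p, p)%N.
have hsE i : aderivs P (map h s ++ [:: interval_sum t (j * p, 1)%N]) =
    aderivs P (nseq (count_mem i s) (h i) ++ map (interval_sum t)
      ([seq (i' * p, p)%N | i' : 'I_m <- seq.filter (predC1 i) s] ++ [:: (j * p, 1)%N])).
  apply: aderivs_perm; rewrite map_cat catA perm_cat2r -map_comp.
  by rewrite (perm_trans (perm_map h (perm_nseq_count i s))) // map_cat map_nseq.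
case: (boolP (has (fun i => p <= count_mem i s)%N s)) => [/hasP[i _ pi]|/hasPn/= hs].
  by rewrite (hsE i) aderivs_repeat_eq0.
case: (boolP (has (predC1 j) s)) => [/hasP[i si /= ij]|]; last first.
  (* If every block were j, then j would occur q >= p times, which the previous case excludes. *)
  rewrite -all_predC (eq_all (a2 := pred1 j)) => [/all_pred1P E|i]; last exact: negbK.
  have js : j \in s by rewrite E mem_nseq eqxx sq andbT; lia.
  by have := hs j js; rewrite {1}E count_nseq sq /= eqxx mul1n; lia.
rewrite (hsE i); set o := _ ++ [:: _].
have im := ltn_ord i.
have imp : (i * p + p <= m * p)%N by rewrite -mulSnr leq_mul2r im orbT.
have tE : t = take (i * p) t ++ take p (drop (i * p) t) ++ drop p (drop (i * p) t).
  by rewrite !cat_take_drop.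
have -> : h i = \sum_(v <- take p (drop (i * p) t)) v.
  rewrite -sum_take size_takel; last by rewrite size_drop st; lia.
  by apply: eq_bigr => a _; rewrite nth_take // nth_drop.
rewrite {2}tE; apply: (@aderivs_block_eq0 _ _ (m * p) q.+1 _ _ k _ _ _ (i * p)) => //.
- by rewrite size_takel // st; lia.
- by rewrite size_takel // size_drop st; lia.
- by rewrite -tE.
- by rewrite -tE st.
- have far (a l : nat) (i' : 'I_m) : i' != i -> (l <= p)%N -> (a = i' * p)%N ->
      (a + l <= i * p \/ i * p + p <= a /\ a + l <= m * p)%N.
    move=> ii lp ->; have i'm := ltn_ord i'.
    have := leq_mul2r p i'.+1 m; rewrite i'm orbT mulSnr => im'.
    case: (ltngtP i' i) => [lt|gt|/ord_inj e]; last by rewrite e eqxx in ii.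
      by left; have := leq_mul2r p i'.+1 i; rewrite lt orbT mulSnr; lia.
    by right; have := leq_mul2r p i.+1 i'; rewrite gt orbT mulSnr; lia.
  move=> a l; rewrite mem_cat => /orP[/mapP[i' + [-> ->]]|].
    by rewrite mem_filter => /andP[/= ii _]; apply: (far _ _ i').
  by rewrite inE => /eqP[-> ->]; apply: (far _ _ j); rewrite 1?eq_sym.
- by rewrite -has_count has_pred1 si ltnNge hs.
- rewrite size_cat size_map size_filter /= addnAC (addnC _ (count_mem i s)).
  by rewrite count_predC sq addn1.
Qed.

Lemma aderivs_span_eq0 p (V : lmodType 'F_p) D m (P : V -> 'F_p) (h g : 'I_m -> V)
    (ys : seq ('I_m -> 'F_p)) z x :
  deg_le D P -> ((size ys).+1 = D)%N ->
  (forall (s : seq 'I_m) j, (size s).+1 = D -> aderivs P (map h s ++ [:: g j]) 0 = 0) ->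
  aderivs P ([seq \sum_i y i *: h i | y : 'I_m -> 'F_p <- ys] ++ [:: \sum_i z i *: g i]) x = 0.
Proof.
move=> dP sys hP.
have scaleE (a : 'F_p) (v : V) : a *: v = v *+ a.
  by rewrite -[in LHS](natr_Zp a) scaler_nat.
have sumE (f : 'I_m -> V) (y : 'I_m -> 'F_p) hs : ((size hs).+1 = D)%N ->
    (forall i, aderivs P (f i :: hs) x = 0) -> aderivs P (\sum_i y i *: f i :: hs) x = 0.
  move=> sh f0; rewrite (aderivs_suml _ _ _ dP) // big1 // => i _.
  by rewrite scaleE (aderivs_mulrnl _ _ _ dP) // f0 mul0rn.
have permE hs v : aderivs P (hs ++ [:: v]) = aderivs P (v :: hs).
  by apply: aderivs_perm; rewrite perm_catC.
rewrite permE; apply: (sumE); first by rewrite size_map.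
move=> j; rewrite -permE.
(* Expand the slots one at a time by linearity; s records the generators already chosen. *)
suff H s : (size ys + size s).+1 = D ->
    aderivs P ([seq \sum_i y i *: h i | y : 'I_m -> 'F_p <- ys] ++ map h s ++ [:: g j]) x = 0.
  by have := H [::]; apply; rewrite addn0.
elim: ys s {sys} => [|y ys IHys] s ss /=.
  by rewrite (aderivs_const _ 0 dP) ?hP // size_cat size_map addn1.
apply: (sumE) => [|i]; first by rewrite !size_cat !size_map /= addn1 addnS.
rewrite (aderivs_perm (t := map (fun y => \sum_i y i *: h i) ys ++ map h (i :: s) ++ [:: g j])).
  by apply: IHys; rewrite /= addnS.
by rewrite -cat1s perm_catCA.
Qed.

(** * A non-classical polynomial of exact degree D in one variable *)

Lemma aderivs_additive (V G H : zmodType) (f : G -> H) (P : V -> G) hs x :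
  {morph f : y z / y - z} -> aderivs (f \o P) hs x = f (aderivs P hs x).
Proof. by move=> fB; elim: hs x => [//|h hs IHs] x; rewrite /= /aderiv !IHs fB. Qed.

Lemma aderivs_cst0 (V G : zmodType) hs (x : V) : aderivs (fun=> 0 : G) hs x = 0.
Proof. by elim: hs x => [//|h hs IHs] x; rewrite /= /aderiv !IHs subrr. Qed.

Lemma Fp_mulr1n p (a : 'F_p) : 1 *+ a = a.
Proof. exact: natr_Zp. Qed.

Lemma Fp_const p (G : zmodType) (Q : 'F_p -> G) x y :
  (forall x, aderiv 1 Q x = 0) -> Q x = Q y.
Proof.
move=> dQ; rewrite -(subrK y x) -(Fp_mulr1n (x - y)).
elim: (nat_of_ord _) => [|n IHn]; first by rewrite mulr0n add0r.
by rewrite -IHn mulrSr addrAC; apply/subr0_eq/dQ.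
Qed.

(** Since 1 generates F_p, a function killed by the difference in direction 1 is constant, hence
    killed in every direction. This trades the directions 1 for arbitrary ones, one by one. *)
Lemma deg_le_Fp p (G : zmodType) d (Q : 'F_p -> G) :
  (forall x, aderivs Q (nseq d.+1 1) x = 0) -> deg_le d Q.
Proof.
move=> dQ hs x sh; suff H s k y : (size s + k = d.+1)%N -> aderivs Q (s ++ nseq k 1) y = 0.
  by have := H hs 0%N x; rewrite cats0; apply; rewrite addn0.
elim: s y k => [|h s IHs] y k; first by rewrite /= add0n => ->.
rewrite /= addSnnS => sk; rewrite /aderiv; apply/eqP; rewrite subr_eq0; apply/eqP.
apply: Fp_const => z; rewrite -[LHS]/(aderivs Q (1 :: s ++ nseq k 1) z).
rewrite (aderivs_perm (t := s ++ nseq k.+1 1)) ?IHs //.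
by rewrite -cat1s perm_catCA.
Qed.

(** If the next difference vanished, the current one would be a nonzero constant. The indicator
    itself is not constant, and a proper difference sums to 0 over F_p, while p times a nonzero
    integer is not 0. *)
Lemma aderivs_delta_neq0 p j : prime p ->
  exists x : 'F_p, aderivs (fun y : 'F_p => (y == 0)%:R : int) (nseq j 1) x != 0.
Proof.
move=> p_prime; elim: j => [|j [x0 IHj]]; first by exists 0.
apply/existsP/contraT => /existsPn d0.
set f := aderivs _ _ in IHj; have {}d0 x : aderiv 1 f x = 0 by have := d0 x; rewrite negbK => /eqP.
have fc x := Fp_const x x0 d0.
case: j => [|j] in f fc IHj d0.
  by have := fc 1; rewrite -(fc 0).
have : \sum_x f x = 0.
  by rewrite /f /= sumrB [X in _ - X](reindex_inj (addIr 1)) /= subrr.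
rewrite (eq_bigr (fun=> f x0)) // sumr_const card_Fp // => /eqP.
by rewrite mulrn_eq0 (negbTE IHj) orbF eqn0Ngt prime_gt0.
Qed.

(** On F_p the shift satisfies S^p = 1, so every p differences produce a factor p. *)
Lemma aderivs_nilpotent p (G : zmodType) (Q : 'F_p -> G) j : prime p ->
  exists g : 'F_p -> G, forall x, aderivs Q (nseq (p * j) 1) x = g x *+ p ^ j.
Proof.
move=> p_prime; elim: j => [|j [g gE]]; first by rewrite muln0; exists Q => x /=.
have [g' g'E] := aderivs_pnseq g 1 p_prime; exists g' => x.
rewrite mulnS nseqD foldr_cat (_ : aderivs Q _ = (fun y => y *+ p ^ j) \o g); last exact/funext.
rewrite (@aderivs_additive _ _ _ (fun y => y *+ p ^ j) g); last by move=> y z; exact: mulrnBl.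
rewrite g'E pchar_Fp_0 // addr0 subrr add0r -mulrnA -expnS //.
Qed.

(* N is an iterated difference of the indicator of 0: the difference operator is nilpotent
   modulo p^t, but none of its powers kills this indicator over the integers, so for
   large t the first vanishing iterate comes after the D-th. *)
Lemma exists_exact_degree p D : prime p ->
  exists q (N : 'F_p -> 'Z_q), [/\ (1 < q)%N, deg_le D N & aderivs N (nseq D 1) 0 != 0].
Proof.
move=> p_prime.
have [x0 dx0] := aderivs_delta_neq0 D p_prime.
set c := aderivs _ _ x0 in dx0.
(* With this choice 0 < |c| = t < p ^ t = q, so c stays nonzero modulo q. *)
pose t := `|c|%N; pose q := (p ^ t)%N.
have tq : (t < q)%N by rewrite ltn_expl ?prime_gt1.
have t_gt0 : (0 < t)%N by rewrite absz_gt0.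
have q1 : (1 < q)%N by apply: leq_ltn_trans tq.
pose b j := aderivs (fun y : 'F_p => (y == 0)%:R : 'Z_q) (nseq j 1).
have bD : b D x0 != 0.
  rewrite /b (_ : (fun y => _) = intr \o (fun y : 'F_p => (y == 0)%:R : int)); last first.
    by apply/funext => y /=; case: (y == 0).
  rewrite aderivs_additive; last exact: rmorphB.
  rewrite -/c (intEsign c) rmorphM rmorph_sign mulrI_eq0; last exact: lreg_sign.
  rewrite -[X in X != _]/(`|c|%N%:R : 'Z_q) -val_eqE.
  by rewrite [val _]val_Zp_nat // modn_small // -lt0n.
have b0 : exists m, [forall x, b m x == 0].
  exists (p * t)%N; apply/forallP => x.
  have [g gE] := aderivs_nilpotent (fun y : 'F_p => (y == 0)%:R : 'Z_q) t p_prime.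
  by rewrite /b gE -mulr_natr -/q pchar_Zp // mulr0.
case: (ex_minnP b0) => m /forallP bm mmin.
have Dm : (D < m)%N.
  rewrite ltnNge; apply/negP => mD; have /negP[] := bD.
  rewrite /b -(subnK mD) nseqD foldr_cat.
  have -> : aderivs (fun y : 'F_p => (y == 0)%:R : 'Z_q) (nseq m 1) = fun=> 0.
    by apply/funext => x; apply/eqP/bm.
  by rewrite aderivs_cst0.
(* The D-th difference of this function is the difference of order m - 1: constant since the next
   one vanishes, and nonzero by minimality of m. *)
exists q, (b (m - D.+1)%N); split=> //.
  apply: deg_le_Fp => x; rewrite /b -foldr_cat -nseqD subnKC //; exact/eqP/bm.
rewrite /b -foldr_cat -nseqD (_ : (D + (m - D.+1) = m - 1)%N); last by lia.
apply/negP => bm1; have := mmin (m - 1)%N; have -> : (m <= m - 1)%N = false by lia.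
move=> h; apply: notF; apply: h; apply/forallP => x.
rewrite (_ : b (m - 1)%N x = b (m - 1)%N 0); first exact: bm1.
have mE : m = (m - 1).+1 by lia.
by apply: Fp_const => y; have := bm y; rewrite {1}mE => /eqP.
Qed.

(** * Averages and van der Corput's inequality *)

Lemma expect_cst (R : realType) (T : finType) (c : R[i]) : (0 < #|T|)%N ->
  expect (fun _ : T => c) = c.
Proof.
move=> T0; rewrite /expect sumr_const -[X in _ * X]mulr_natl mulrA mulVf ?mul1r //.
by rewrite pnatr_eq0 -lt0n.
Qed.

Lemma expectMl (R : realType) (T : finType) (F : T -> R[i]) c :
  expect (fun x => c * F x) = c * expect F.
Proof. by rewrite /expect -mulr_sumr mulrCA. Qed.

Lemma expectMr (R : realType) (T : finType) (F : T -> R[i]) c :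
  expect (fun x => F x * c) = expect F * c.
Proof. by rewrite /expect -mulr_suml mulrA. Qed.

Lemma expectB (R : realType) (T : finType) (F G : T -> R[i]) :
  expect (fun x => F x - G x) = expect F - expect G.
Proof. by rewrite /expect sumrB mulrBr. Qed.

Lemma expect_conj (R : realType) (T : finType) (F : T -> R[i]) :
  (expect F)^* = expect (fun x => (F x)^*).
Proof. by rewrite /expect rmorphM rmorph_sum fmorphV rmorph_nat. Qed.

Lemma eq_expect (R : realType) (T : finType) (F G : T -> R[i]) :
  F =1 G -> expect F = expect G.
Proof. by move=> /funext ->. Qed.

Lemma expect_exchange (R : realType) (S T : finType) (F : S -> T -> R[i]) :
  expect (fun x => expect (F x)) = expect (fun y => expect (F^~ y)).
Proof.
rewrite /expect -!mulr_sumr exchange_big /= !mulrA [X in X * _]mulrC; congr (_ * _).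
Qed.

Lemma expect_shift (R : realType) (V : finZmodType) (F : V -> R[i]) a :
  expect (fun x => F (x + a)) = expect F.
Proof. by rewrite /expect [in RHS](reindex_inj (addIr a)). Qed.

Lemma ler_expect (R : realType) (T : finType) (F G : T -> R[i]) :
  (forall x, F x <= G x) -> expect F <= expect G.
Proof. by move=> FG; rewrite /expect ler_wpM2l ?invr_ge0 ?ler0n // ler_sum. Qed.

Lemma norm_expect (R : realType) (T : finType) (F : T -> R[i]) :
  `|expect F| <= expect (fun x => `|F x|).
Proof.
by rewrite /expect normrM ger0_norm ?invr_ge0 ?ler0n // ler_wpM2l ?invr_ge0 ?ler0n // ler_norm_sum.
Qed.

(** The right side minus the left side is the variance of F. *)
Lemma norm_expect_sqr (R : realType) (T : finType) (F : T -> R[i]) : (0 < #|T|)%N ->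
  `|expect F| ^+ 2 <= expect (fun x => `|F x| ^+ 2).
Proof.
move=> T0; set m := expect F.
suff -> : expect (fun x => `|F x| ^+ 2) = `|m| ^+ 2 + expect (fun x => `|F x - m| ^+ 2).
  by rewrite lerDl -(expect_cst 0 T0) ler_expect // => x; rewrite exprn_ge0.
have -> : (fun x => `|F x - m| ^+ 2) =
    fun x => (`|F x| ^+ 2 - F x * m^*) - (m * (F x)^* - m * m^*).
  by apply/funext => x; rewrite !normCK rmorphB /=; ring.
rewrite !expectB expectMr expectMl -expect_conj expect_cst // -/m normCK; ring.
Qed.

Lemma norm_expect_exp2 (R : realType) (T : finType) (F : T -> R[i]) r : (0 < #|T|)%N ->
  `|expect F| ^+ (2 ^ r) <= expect (fun x => `|F x| ^+ (2 ^ r)).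
Proof.
move=> T0; elim: r => [|r IHr]; first by rewrite !expr1 norm_expect.
rewrite expnSr exprM; apply: le_trans (_ : expect (fun x => `|F x| ^+ (2 ^ r)) ^+ 2 <= _).
  rewrite lerXn2r ?nnegrE ?exprn_ge0 //.
  by rewrite -(expect_cst 0 T0) ler_expect // => x; rewrite exprn_ge0.
have := norm_expect_sqr (fun x => `|F x| ^+ (2 ^ r)) T0.
rewrite ger0_norm; last by rewrite -(expect_cst 0 T0) ler_expect // => x; rewrite exprn_ge0.
move=> /le_trans; apply; apply: ler_expect => x.
by rewrite normrX normr_id exprM.
Qed.

Lemma finZmod_card_gt0 (V : finZmodType) : (0 < #|V|)%N.
Proof. by apply/card_gt0P; exists 0. Qed.

(** Average u over its translates by phi y, apply Cauchy-Schwarz in x, and expand the square: only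
    the difference of the two translations survives. *)
Lemma vdC_step (R : realType) (V Y : finZmodType) (phi : Y -> V) (u : V -> R[i]) :
  {morph phi : y z / y + z} ->
  `|expect u| ^+ 2 <= expect (fun y => expect (mderiv (phi y) u)).
Proof.
move=> phiD; have Y0 := finZmod_card_gt0 Y; have V0 := finZmod_card_gt0 V.
have -> : expect u = expect (fun x => expect (fun y => u (x + phi y))).
  rewrite expect_exchange -[LHS](expect_cst _ Y0); congr expect.
  by apply/funext => y; rewrite expect_shift.
apply: le_trans (norm_expect_sqr _ V0) _; rewrite le_eqVlt; apply/orP; left; apply/eqP.
transitivity (expect (fun y' => expect (fun y => expect (fun x =>
  u (x + phi (y + y')) * (u (x + phi y'))^*)))).
  under [RHS]eq_expect => y' do rewrite expect_exchange.
  rewrite [RHS]expect_exchange; congr expect; apply/funext => x.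
  rewrite normCK expect_conj -expectMl; congr expect; apply/funext => y'.
  by rewrite -expectMr -(expect_shift _ y').
rewrite -[RHS](expect_cst _ Y0); congr expect; apply/funext => y'.
congr expect; apply/funext => y; rewrite -(expect_shift _ (phi y')); congr expect.
by apply/funext => x; rewrite /mderiv phiD (addrC (phi y)) addrA.
Qed.

(** The bound A is left abstract so that this shift may range over another subgroup than the shifts
    hidden in A. *)
Lemma vdC_induct (R : realType) (V Y : finZmodType) (phi : Y -> V)
    (A : (V -> R[i]) -> R[i]) r (u : V -> R[i]) :
  {morph phi : y z / y + z} -> (forall w, `|expect w| ^+ (2 ^ r) <= A w) ->
  `|expect u| ^+ (2 ^ r.+1) <= expect (fun y => A (mderiv (phi y) u)).
Proof.
move=> phiD leA; have step := vdC_step u phiD.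
rewrite expnS exprM; apply: le_trans (_ : `|expect (fun y => expect (mderiv (phi y) u))| ^+
  (2 ^ r) <= _).
  rewrite lerXn2r ?nnegrE ?exprn_ge0 //.
  (* The order on R[i] is partial; an upper bound of a nonnegative number is real, hence at most its
     modulus. *)
  apply: (le_trans step); apply: real_ler_norm; apply: ger0_real.
  by apply: le_trans step; rewrite exprn_ge0.
apply: le_trans (norm_expect_exp2 _ _ (finZmod_card_gt0 Y)) _.
exact: ler_expect.
Qed.

Fixpoint deriv_average (R : realType) (V Y : finZmodType) (phi : Y -> V) n (u : V -> R[i]) :=
  if n is n'.+1 then expect (fun y => deriv_average phi n' (mderiv (phi y) u))
  else expect u.

Lemma vdC (R : realType) (V Y : finZmodType) (phi : Y -> V) n (u : V -> R[i]) :
  {morph phi : y z / y + z} -> `|expect u| ^+ (2 ^ n.+1) <= deriv_average phi n.+1 u.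
Proof.
move=> phiD; elim: n u => [|n IHn] u; [exact: vdC_step|].
exact: (vdC_induct (A := deriv_average phi n.+1)).
Qed.

Lemma expect_prod (R : realType) (T : finType) m (F : 'I_m -> T -> R[i]) :
  expect (fun y : 'rV[T]_m => \prod_i F i (y 0 i)) = \prod_i expect (F i).
Proof.
rewrite /expect big_split /= prodr_const card_ord card_mx mul1n natrX exprVn.
rewrite bigA_distr_bigA; congr (_ * _).
rewrite (reindex (fun f : {ffun 'I_m -> T} => \row_i f i)) /=.
  by apply: eq_bigr => f _; apply: eq_bigr => i _; rewrite mxE.
exists (fun y : 'rV[T]_m => [ffun i => y 0 i]) => [f|y] _.
  by apply/ffunP => i; rewrite ffunE mxE.
by apply/rowP => i; rewrite mxE ffunE.
Qed.

(** * Characters *)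

Definition is_char (R : realType) (G : zmodType) (chi : G -> R[i]) :=
  {morph chi : a b / a + b >-> a * b} /\ forall a, `|chi a| = 1.

Lemma char0 (R : realType) (G : zmodType) (chi : G -> R[i]) : is_char chi -> chi 0 = 1.
Proof.
move=> [chiD chi1]; have chi0 : chi 0 != 0 by rewrite -normr_eq0 chi1 oner_eq0.
by apply: (mulfI chi0); rewrite -chiD addr0 mulr1.
Qed.

Lemma charN (R : realType) (G : zmodType) (chi : G -> R[i]) a :
  is_char chi -> chi (- a) = (chi a)^*.
Proof.
move=> chiP; have [chiD chi1] := chiP; have chi0 : chi a != 0 by rewrite -normr_eq0 chi1 oner_eq0.
by apply: (mulfI chi0); rewrite -chiD subrr -normCK chi1 expr1n char0.
Qed.

Lemma char_mulrn (R : realType) (G : zmodType) (chi : G -> R[i]) a n :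
  is_char chi -> chi (a *+ n) = chi a ^+ n.
Proof.
move=> chiP; have [chiD chi1] := chiP.
by elim: n => [|n IHn]; rewrite ?mulr0n ?char0 // mulrS exprS chiD IHn.
Qed.

Lemma char_sum (R : realType) (G : zmodType) (chi : G -> R[i]) (I : Type) (s : seq I) (F : I -> G) :
  is_char chi -> chi (\sum_(i <- s) F i) = \prod_(i <- s) chi (F i).
Proof. by move=> chiP; apply: big_morph; [exact: chiP.1|exact: char0]. Qed.

Lemma mderivs_char (R : realType) (V G : zmodType) (chi : G -> R[i]) (F : V -> G) hs x :
  is_char chi -> foldr (@mderiv R V) (chi \o F) hs x = chi (aderivs F hs x).
Proof.
move=> chiP; elim: hs x => [//|h hs IHs] x.
by rewrite /= /mderiv /aderiv !IHs chiP.1 charN.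
Qed.

Lemma mderivsM (R : realType) (V : zmodType) (f g : V -> R[i]) hs x :
  foldr (@mderiv R V) (fun y => f y * g y) hs x =
    foldr (@mderiv R V) f hs x * foldr (@mderiv R V) g hs x.
Proof.
elim: hs x => [//|h hs IHs] x; rewrite /= /mderiv !IHs rmorphM /=; ring.
Qed.

(** The polynomial X^q - 1 splits into distinct factors, which yields a primitive q-th root of unity
    w; the character is a |-> w ^ a. *)
Lemma exists_faithful_char (R : realType) q : (1 < q)%N ->
  exists chi : 'Z_q -> R[i], is_char chi /\ forall a, chi a = 1 -> a = 0.
Proof.
move=> q1; have q0 : (0 < q)%N by apply: ltn_trans q1.
have [w wq] : exists w : R[i], q.-primitive_root w.
  have [rs rsE] := closed_field_poly_normal ('X^q - 1 : {poly R[i]}).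
  rewrite (monicP _) ?monicXnsubC // scale1r in rsE.
  have /hasP[w _ wP] : has q.-primitive_root rs.
    apply: has_prim_root => //.
    - by apply/allP => w; rewrite -root_prod_XsubC -rsE.
    - by rewrite -separable_prod_XsubC -rsE separable_Xn_sub_1 // pnatr_eq0 -lt0n.
    - by have := size_XnsubC (1 : R[i]) q0; rewrite rsE size_prod_XsubC => -[->].
  by exists w.
have Zq : (Zp_trunc q).+2 = q by exact: Zp_cast.
have wn : `|w| = 1.
  by apply/eqP; rewrite -(@pexpr_eq1 _ _ q) // -normrX prim_expr_order // normr1.
exists (fun a => w ^+ a); split=> [|a /eqP]; first split=> [a b|a].
- have wq' : (Zp_trunc q).+2.-primitive_root w by rewrite Zq.
  by rewrite -exprD /= (prim_expr_mod wq').
- by rewrite normrX wn expr1n.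
- rewrite -(prim_order_dvd wq) => qa; apply: val_inj => /=.
  by apply/eqP; rewrite -[_ == _]negbK -lt0n; apply/negP => a0;
    have := dvdn_leq a0 qa; rewrite leqNgt -[X in (_ < X)%N]Zq ltn_ord.
Qed.

Lemma ep_char (R : realType) p : prime p -> is_char (@ep R p).
Proof.
move=> p_prime; have p0 : p%:R != 0 :> R by rewrite pnatr_eq0 -lt0n prime_gt0.
split=> [a b|a]; last first.
  by rewrite normc_def /= cos2Dsin2 sqrtr1.
have pE : (Zp_trunc (pdiv p)).+2 = p by exact: Fp_cast.
have abE : nat_of_ord (a + b) = ((a + b) %% p)%N by rewrite /=; congr (_ %% _)%N.
rewrite /ep abE; set s := 2 * pi * _ / _; set x := 2 * pi * _ / _; set y := 2 * pi * _ / _.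
(* Reducing a + b modulo p changes the angle by whole turns. *)
have xyE : x + y = s + (pi *+ 2) *+ ((a + b) %/ p).
  have /(congr1 (fun n => n%:R : R)) := divn_eq (a + b) p.
  rewrite !natrD natrM /x /y /s -!mulrDl -mulrDr => ->.
  by rewrite -[X in _ = _ + X]mulr_natr mulrDr mulrDl; field.
rewrite -(periodicn (@cosD2pi R) ((a + b) %/ p) s) -(periodicn (@sinD2pi R) ((a + b) %/ p) s).
by rewrite -xyE cosD sinD; congr Complex; rewrite // addrC.
Qed.

(** * Averages of a diagonal multilinear form *)

Fixpoint iter_average (R : realType) (T : finType) (F : seq T -> R[i]) n s :=
  if n is n'.+1 then expect (fun v => iter_average F n' (v :: s)) else F s.

Lemma norm_expect_le1 (R : realType) (T : finType) (F : T -> R[i]) : (0 < #|T|)%N ->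
  (forall x, `|F x| <= 1) -> `|expect F| <= 1.
Proof.
move=> T0 F1; apply: le_trans (norm_expect F) _.
by rewrite -[leRHS](expect_cst 1 T0); exact: ler_expect.
Qed.

Lemma norm_expect_lt1 (R : realType) (T : finType) (F : T -> R[i]) a :
  (forall x, `|F x| <= 1) -> `|F a| < 1 -> `|expect F| < 1.
Proof.
move=> F1 Fa; have T0 : (0 < #|T|)%N by apply/card_gt0P; exists a.
apply: le_lt_trans (norm_expect F) _; rewrite -[ltRHS](expect_cst 1 T0) /expect.
rewrite ltr_pM2l ?invr_gt0 ?ltr0n // (bigD1 a) //= [ltRHS](bigD1 a) //=.
by rewrite ltr_leD // ler_sum.
Qed.

Lemma norm_iter_average_le1 (R : realType) (T : finType) (F : seq T -> R[i]) n s :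
  (0 < #|T|)%N -> (forall s, `|F s| <= 1) -> `|iter_average F n s| <= 1.
Proof.
by move=> T0 F1; elim: n s => [|n IHn] s //=; apply: norm_expect_le1.
Qed.

(** All averages have modulus at most 1, so a single innermost average below 1, here with the other
    arguments fixed to a, makes the total strictly smaller. *)
Lemma norm_iter_average_lt1 (R : realType) (T : finType) (F : seq T -> R[i]) n a s :
  (forall s, `|F s| <= 1) -> `|iter_average F 1 (nseq n a ++ s)| < 1 ->
  `|iter_average F n.+1 s| < 1.
Proof.
move=> F1; have T0 : (0 < #|T|)%N by apply/card_gt0P; exists a.
elim: n s => [//|n IHn] s h; apply: (norm_expect_lt1 (a := a)) => [v|].
  exact: (norm_iter_average_le1 n.+1 (v :: s) T0 F1).
by apply: IHn; rewrite -cat_rcons -cats1 -[[:: a]]/(nseq 1 a) -nseqD addn1.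
Qed.

(** The i-th factor involves only the i-th coordinates of the directions, and these are independent.
    The direction z stays fixed, and new arguments enter at the front as derivatives do. *)
Lemma deriv_average_prod (R : realType) (V : finZmodType) (T : finZmodType) m
    (phi : 'rV[T]_m -> V) (F : seq T -> R[i]) (u : V -> R[i]) q hs
    (z : 'rV[T]_m) n (ys : seq 'rV[T]_m) :
  (forall ys x, size ys = q ->
    foldr (@mderiv R V) u (map phi ys ++ hs) x =
      \prod_i F ([seq y 0 i | y : 'rV[T]_m <- ys] ++ [:: z 0 i])) ->
  (size ys + n = q)%N ->
  deriv_average phi n (foldr (@mderiv R V) u (map phi ys ++ hs)) =
    \prod_i iter_average F n ([seq y 0 i | y : 'rV[T]_m <- ys] ++ [:: z 0 i]).
Proof.
move=> uF; elim: n ys => [|n IHn] ys sys /=.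
  have <- := expect_cst (\prod_i F ([seq y 0 i | y : 'rV[T]_m <- ys] ++ [:: z 0 i]))
    (finZmod_card_gt0 V).
  by apply: eq_expect => x; rewrite uF // -sys addn0.
rewrite -expect_prod; apply: eq_expect => y.
by rewrite -(IHn (y :: ys)) //= addSnnS.
Qed.

(** With the other arguments equal to 1, the innermost average runs over the powers of chi c, a p-th
    root of unity other than 1, and so is 0. *)
Lemma norm_iter_average_char (R : realType) p q (G : zmodType) (N : 'F_p -> G) (chi : G -> R[i]) :
  prime p -> is_char chi -> (forall a, chi a = 1 -> a = 0) ->
  deg_le q.+1 N -> aderivs N (nseq q.+1 1) 0 != 0 ->
  `|iter_average (fun s => chi (aderivs N s 0)) q.+1 [::]| < 1.
Proof.
move=> p_prime chiP chi_inj dN N0.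
apply: (norm_iter_average_lt1 (a := 1)) => [s|]; first by rewrite chiP.2.
rewrite cats0 /=; set c := aderivs _ _ _ in N0.
have cE (v : 'F_p) : aderivs N (v :: nseq q 1) 0 = c *+ v.
  by rewrite -{1}(Fp_mulr1n v) (aderivs_mulrnl _ _ _ dN) // size_nseq.
have cp : c *+ p = 0.
  by rewrite -(aderivs_mulrnl _ _ _ dN) ?size_nseq // pchar_Fp_0 // aderivs0 ?mem_head.
suff -> : expect (fun v : 'F_p => chi (aderivs N (v :: nseq q 1) 0)) = 0 by rewrite normr0 ltr01.
rewrite /expect; under eq_bigr do rewrite cE char_mulrn //.
have pE : (Zp_trunc (pdiv p)).+2 = p by exact: Fp_cast.
rewrite -(big_mkord xpredT (fun i => chi c ^+ i)) pE big_mkord.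
have chic : chi c - 1 != 0 by rewrite subr_eq0; apply: contra N0 => /eqP/chi_inj ->.
by rewrite -[X in _ * X](mulKf chic) -subrX1 -char_mulrn // cp char0 // subrr !mulr0.
Qed.

(** * Restriction to the blocks *)

Definition coord_sum (K G : zmodType) n (N : K -> G) (x : 'rV[K]_n) : G := \sum_a N (x 0 a).

Lemma aderivs_coord_sum (K G : zmodType) n (N : K -> G) hs (x : 'rV[K]_n) :
  aderivs (coord_sum N) hs x = \sum_a aderivs N [seq h 0 a | h : 'rV[K]_n <- hs] (x 0 a).
Proof.
rewrite aderivs_sum; apply: eq_bigr => a _.
by rewrite (aderivs_comp (E := fun y : 'rV[K]_n => y 0 a) N) // => y z; rewrite mxE.
Qed.

Section DiagonalRestriction.
Variables (p n m : nat) (idx : seq 'I_n) (a0 : 'I_n).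
Hypotheses (p_gt0 : (0 < p)%N) (idx_uniq : uniq idx) (size_idx : size idx = (m * p + p)%N).

Let V := 'rV['F_p]_n.
Let t : seq V := map (delta_mx 0) idx.
Let block (i : 'I_m) : V := interval_sum t (i * p, p)%N.
Let point (i : 'I_m) : V := interval_sum t (i * p, 1)%N.
Let head_idx (i : 'I_m) : 'I_n := nth a0 idx (i * p).

Definition block_span (y : 'rV['F_p]_m) : V := \sum_i y 0 i *: block i.
Definition point_span (z : 'rV['F_p]_m) : V := \sum_i z 0 i *: point i.

Let lt_idx (i : 'I_m) j : (j < p)%N -> (i * p + j < size idx)%N.
Proof. by move=> jp; have := leq_mul2r p i.+1 m; rewrite ltn_ord orbT mulSnr size_idx; lia. Qed.

Let tE (i : 'I_m) j : (j < p)%N -> t`_(i * p + j) = delta_mx 0 (nth a0 idx (i * p + j)).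
Proof. by move=> jp; rewrite (nth_map a0) // lt_idx. Qed.

Let pointE i : point i = delta_mx 0 (head_idx i).
Proof. by rewrite /point /interval_sum big_ord1 /= (tE i p_gt0) addn0. Qed.

Let head_idx_eq (i i' : 'I_m) j : (j < p)%N ->
  (head_idx i == nth a0 idx (i' * p + j)) = (i == i') && (j == 0%N).
Proof.
move=> jp; rewrite /head_idx nth_uniq ?lt_idx //; last by have := lt_idx i p_gt0; rewrite addn0.
apply/eqP/andP => [E|[/eqP -> /eqP ->]]; last by rewrite addn0.
have := congr1 (modn^~ p) E; rewrite modnMl modnMDl modn_small // => j0.
move: E; rewrite -j0 addn0 => /eqP; rewrite eqn_pmul2r // => /eqP/ord_inj ->.
Qed.

Let block_span_head (y : 'rV['F_p]_m) i : block_span y 0 (head_idx i) = y 0 i.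
Proof.
rewrite /block_span summxE (bigD1 i) //= big1 ?addr0 => [|i' i'i].
  rewrite mxE /block /interval_sum summxE (bigD1 (Ordinal p_gt0)) //= big1 => [|j j0].
    by rewrite tE // mxE eqxx head_idx_eq // !eqxx addr0 mulr1.
  by rewrite tE // mxE eqxx head_idx_eq // eqxx -[_ == _ :> nat]/(j == Ordinal p_gt0) (negbTE j0).
rewrite mxE /block /interval_sum summxE big1 ?mulr0 // => j _.
by rewrite tE // mxE eqxx head_idx_eq // eq_sym (negbTE i'i).
Qed.

Let point_span_head (z : 'rV['F_p]_m) i : point_span z 0 (head_idx i) = z 0 i.
Proof.
rewrite /point_span summxE (bigD1 i) //= big1 ?addr0 => [|i' i'i].
  by rewrite mxE pointE mxE !eqxx mulr1.
have := head_idx_eq i i' p_gt0; rewrite addn0 => h.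
by rewrite mxE pointE mxE eqxx /= {2}/head_idx h eq_sym (negbTE i'i) mulr0.
Qed.

Let point_span_other (z : 'rV['F_p]_m) a : a \notin codom head_idx -> point_span z 0 a = 0.
Proof.
move=> ha; rewrite /point_span summxE big1 // => i _; rewrite mxE pointE mxE eqxx /=.
case: eqP => [aE|_]; last by rewrite mulr0.
by rewrite aE codom_f in ha.
Qed.

(** Off the heads of the blocks the last direction has coordinate 0 and kills the term. At the head
    of block i the coordinates of the directions are y 0 i and z 0 i. *)
Lemma aderivs_coord_sum_diag (G : zmodType) q (N : 'F_p -> G) (ys : seq 'rV['F_p]_m) z x :
  deg_le q.+1 N -> size ys = q ->
  aderivs (coord_sum N) (map block_span ys ++ [:: point_span z]) x =
    \sum_i aderivs N ([seq y 0 i | y : 'rV['F_p]_m <- ys] ++ [:: z 0 i]) 0.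
Proof.
move=> dN sys; rewrite aderivs_coord_sum.
rewrite (bigID (mem (codom head_idx))) /= [X in _ + X]big1 ?addr0 => [|a ha]; last first.
  by rewrite aderivs0 // map_cat mem_cat /= point_span_other // mem_head orbT.
have inj : injective head_idx.
  move=> i i' /eqP; have := head_idx_eq i i' p_gt0; rewrite addn0 => ->.
  by rewrite andbT => /eqP.
(* Heads are indexed by their blocks through a partial inverse of the injection [head_idx]. *)
rewrite (reindex_omap head_idx (fun a => [pick i | head_idx i == a])) /=; last first.
  by move=> a /codomP[i ->]; case: pickP => [j /eqP e|/(_ i)] /=; [rewrite e|rewrite eqxx].
rewrite (eq_bigl xpredT) => [|i]; last first.
  by rewrite codom_f /=; case: pickP => [j /eqP/inj ->|/(_ i)]; rewrite eqxx.
apply: eq_bigr => i _.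
rewrite (aderivs_const _ 0 dN); last by rewrite size_map size_cat size_map sys addn1.
rewrite map_cat -map_comp /= point_span_head; congr (aderivs N (_ ++ _) 0).
by apply: eq_map => y; rewrite /= block_span_head.
Qed.

End DiagonalRestriction.

(** * The correlation bound and the theorem *)

Lemma poly_le_deg p n d (P : 'rV['F_p]_n -> 'F_p) : poly_le d P <-> deg_le d P.
Proof.
split=> [dP hs x shs|dP hs x]; last by apply: dP; rewrite size_tuple.
by have := dP (tcast shs (in_tuple hs)) x; rewrite val_tcast.
Qed.

Lemma deg_le_coord_sum (K G : zmodType) n d (N : K -> G) :
  deg_le d N -> deg_le d (@coord_sum K G n N).
Proof.
move=> dN hs x shs; rewrite aderivs_coord_sum big1 // => a _.
by rewrite dN // size_map.
Qed.

(** The threshold n0 comes from Ramsey's theorem and so serves all P at once. The first shift is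
    taken in the span of the points, the other q in the span of the blocks. *)
Lemma correlation_bound (R : realType) p q (G : zmodType) (N : 'F_p -> G) (chi : G -> R[i]) m :
  prime p -> (p <= q)%N -> is_char chi -> deg_le q.+1 N ->
  exists n0, forall n (P : 'rV['F_p]_n -> 'F_p), (n0 <= n)%N -> poly_le q.+1 P ->
    `|expect (fun x => chi (coord_sum N x) * ep R (- P x))| ^+ (2 ^ q.+1) <=
      iter_average (fun s => chi (aderivs N s 0)) q.+1 [::] ^+ m.
Proof.
move=> p_prime pq chiP dN; have p_gt0 := prime_gt0 p_prime.
have epP := ep_char R p_prime.
(* Colours are functions on F_p^(m * p), one coordinate for each point of the m blocks; p more
   entries are requested as the spare ones. *)
have [n0 n0P] := ramsey {ffun 'rV['F_p]_(m * p) -> 'F_p} (m * p) (m * p + p).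
(* The 1 ensures that there is an index a0, the default value for [nth]. *)
exists (maxn n0 1) => n P; rewrite geq_max => /andP[n0n n_gt0] /poly_le_deg dP.
have a0 : 'I_n := Ordinal n_gt0.
pose V := 'rV['F_p]_n.
pose basis : seq V := map (delta_mx 0) (enum 'I_n).
have [|t [k [/subseqP[b sb tb] st hk]]] := n0P _ (fun e => [ffun y => P (comb e y)]) basis.
  by rewrite size_map size_enum_ord.
pose idx := mask b (enum 'I_n).
have tE : t = map (delta_mx 0) idx by rewrite tb /basis map_mask.
have idx_uniq : uniq idx by rewrite mask_uniq // enum_uniq.
have size_idx : size idx = (m * p + p)%N by rewrite -st tE size_map.
pose phi := @block_span p n m idx; pose psi := @point_span p n m idx.
have phiD : {morph phi : y z / y + z}.
  by move=> y z; rewrite /phi /block_span -big_split; apply: eq_bigr => i _; rewrite mxE scalerDl.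
have psiD : {morph psi : y z / y + z}.
  by move=> y z; rewrite /psi /point_span -big_split; apply: eq_bigr => i _; rewrite mxE scalerDl.
pose u (x : V) := chi (coord_sum N x) * ep R (- P x).
pose F s := chi (aderivs N s 0).
(* The form of P vanishes in these directions, so the factor from P is 1 and only the diagonal form
   of N is left. *)
have uF z ys x : size ys = q ->
    foldr (@mderiv R V) u (map phi ys ++ [:: psi z]) x =
      \prod_i F ([seq y 0 i | y : 'rV['F_p]_m <- ys] ++ [:: z 0 i]).
  move=> sys; rewrite /u mderivsM (mderivs_char (coord_sum N)) //.
  rewrite (mderivs_char (fun x => - P x)) // (aderivs_additive (f := -%R) P); last first.
    by move=> y w; rewrite opprD.
  rewrite (_ : aderivs P _ x = 0) ?oppr0 ?char0 // ?mulr1.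
    rewrite (aderivs_coord_sum_diag a0 p_gt0 idx_uniq size_idx _ _ dN) //.
    exact: char_sum.
  have := @aderivs_span_eq0 p V q.+1 m P (fun i => interval_sum t (i * p, p)%N)
    (fun i => interval_sum t (i * p, 1)%N) (map (fun y : 'rV['F_p]_m => y 0) ys) (z 0) x dP.
  rewrite size_map sys => /(_ erefl); rewrite -map_comp tE; apply=> s j [ss].
  rewrite -tE; apply: (aderivs_homogeneous_eq0 j p_prime dP pq ss st (k := k)) => e et se.
  by apply/funext => y; rewrite -(hk e et se) ffunE.
(* The outermost average becomes one over z, with one independent coordinate for each block. *)
have -> : iter_average F q.+1 [::] ^+ m = \prod_(i < m) expect (fun v => iter_average F q [:: v]).
  by rewrite prodr_const card_ord.
rewrite -expect_prod.
have q_gt0 : (0 < q)%N by apply: leq_trans pq.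
have vdCq (w : V -> R[i]) : `|expect w| ^+ (2 ^ q) <= deriv_average phi q w.
  by have := vdC q.-1 w phiD; rewrite (prednK q_gt0).
have := vdC_induct u psiD vdCq.
move=> /le_trans; apply; rewrite le_eqVlt; apply/orP; left; apply/eqP.
apply: eq_expect => z; have := deriv_average_prod (ys := [::]) (uF z) (add0n q).
by move=> /= <-.
Qed.

Lemma norm_cmod (R : realType) (z : R[i]) : `|z| = (cmod z)%:C%C.
Proof. by []. Qed.

Theorem theorem1p2 (R : realType) (p k : nat) (p_prime : prime p)
    (p2_le_k : (p + 2 <= k)%N) :
  exists eps : nat -> R,
    (forall n : nat, (0 < n)%N -> 0 <= eps n) /\
    (eps n @[n --> \oo] --> (0 : R)) /\
    forall n : nat, (0 < n)%N ->
      exists f : 'rV['F_p]_n -> R[i],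
        sup_norm f <= 1 /\
        gowers_norm k f = 1 /\
        forall P : 'rV['F_p]_n -> 'F_p, poly_le k.-1 P ->
          cmod (expect (fun x => f x * ep R (- P x))) <= eps n.
Proof.
have p2 := prime_gt1 p_prime.
(* The degree D = k - 1 is q.+1, and p + 2 <= k becomes p <= q. *)
have [q kE] : exists q, k = q.+2 by exists (k - 2)%N; lia.
rewrite {}kE /= in p2_le_k *.
have pq : (p <= q)%N by lia.
have [r [N [r1 dN N0]]] := exists_exact_degree q.+1 p_prime.
have [chi [chiP chi_inj]] := exists_faithful_char R r1.
pose f n (x : 'rV['F_p]_n) := chi (coord_sum N x).
pose corr n (P : 'rV['F_p]_n -> 'F_p) := cmod (expect (fun x => f n x * ep R (- P x))).
(* The largest correlation over the finitely many P, so that only its convergence to 0 needs an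
   argument. *)
pose eps n := \big[Num.max/0]_(P : {ffun 'rV['F_p]_n -> 'F_p} | `[< poly_le q.+1 P >]) corr n P.
pose kappa := iter_average (fun s => chi (aderivs N s 0)) q.+1 [::].
have kappa1 : cmod kappa < 1.
  have := norm_iter_average_char p_prime chiP chi_inj dN N0.
  by rewrite norm_cmod ltcR.
have cmod_ge0 (z : R[i]) : 0 <= cmod z by rewrite -lecR -norm_cmod normr_ge0.
exists eps; split; [|split].
- by move=> n _; exact: bigmax_ge_id.
- apply/cvgr0Pnorm_lt => e e_gt0.
  have e2_gt0 : 0 < e ^+ (2 ^ q.+1) by rewrite exprn_gt0.
  (* First m is chosen from e, then n0 from m. *)
  have : (cmod kappa ^+ m) @[m --> \oo] --> (0 : R) by apply: cvg_expr; rewrite ger0_norm.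
  move=> /cvgr0Pnorm_lt/(_ _ e2_gt0)[m _ /(_ m (leqnn m))] /=.
  rewrite ger0_norm ?exprn_ge0 // => km.
  have [n0 n0P] := correlation_bound m p_prime pq chiP dN.
  near=> n; rewrite ger0_norm; last exact: bigmax_ge_id.
  apply/bigmax_ltP; split=> // P /asboolP dP.
  rewrite -(@ltr_pXn2r _ (2 ^ q.+1)) ?nnegrE ?expn_gt0 ?cmod_ge0 ?(ltW e_gt0) //.
  apply: le_lt_trans km; rewrite -lecR !rmorphXn /= -!norm_cmod.
  apply: le_trans (n0P n P _ dP) _; first by near: n; exists n0.
  (* The bound is kappa ^+ m itself; lying above a nonnegative number it is real, hence at most its
     modulus. *)
  rewrite -normrX; apply: real_ler_norm; apply: ger0_real.
  by apply: le_trans (n0P n P _ dP); [rewrite exprn_ge0|near: n; exists n0].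
- move=> n n_gt0; exists (f n); split; [|split].
  + apply/bigmax_leP; split=> // x _; rewrite -lecR -norm_cmod; by rewrite chiP.2.
  (* Each k-fold derivative of f n is chi of a derivative of order q.+2 of a map of degree at most
     q.+1, that is chi 0 = 1. *)
  + rewrite /gowers_norm (_ : expect _ = 1) ?[cmod 1]ComplexField.Normc.normc1 ?powR1 //.
    transitivity (expect (fun _ : 'rV['F_p]_n * q.+2.-tuple 'rV['F_p]_n => 1 : R[i])); last first.
      by rewrite expect_cst //; apply/card_gt0P; exists (0, nseq_tuple _ 0).
    apply: eq_expect => -[x hs] /=.
    rewrite (mderivs_char (@coord_sum _ _ n N)) // (deg_le_coord_sum dN) ?char0 //.
    by rewrite size_tuple.
  + move=> P dP; have PE : [ffun x => P x] = P :> (_ -> _) by apply/funext => x; rewrite ffunE.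
    rewrite -[leLHS]/(corr n P) -PE; apply: (le_bigmax_cond _ (fun P : {ffun _ -> _} => corr n P)).
    by apply/asboolP; rewrite PE.
Unshelve. all: end_near.
Qed.
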